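(* Let $X$ be a finite set, $n\ge1$, $\mu$ a probability measure on $X^n$, $f:X^n\to\mathbb{R}_+$ with $\mathbb E_\mu f=1$, and $\mathcal T$ a collection of $k$-juntas $X^n\to\mathbb{R}$. Then for every $\epsilon>0$ there exists a nonnegative $k'$-junta $\tilde f:X^n\to\mathbb{R}_+$ with $\mathbb E_\mu\tilde f=1$, where $k'\le C\frac{k}{\epsilon^2}D(f\,\|\,\mu)\,\Delta(\mathcal T)^2$ for a universal constant $C>0$, such that for every $g\in\mathcal T$, $\mathbb E_{x\sim\mu}\,g(x)(f(x)-\tilde f(x))\le\epsilon$.
   Context: A function $h:X^n\to\mathbb{R}$ is a $k$-junta if there is $S\subseteq[n]$ with $|S|=k$ such that $h(x)=h(x')$ whenever $x|_S=x'|_S$. $\Delta(\mathcal T)=\sup_{g\in\mathcal T}\|g\|_\infty$. $D(f\,\|\,\mu)=\mathbb E_\mu[f\log f]$. *)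

(* Defs.v *)
From mathcomp Require Import all_boot all_order all_algebra.
From mathcomp Require Import all_classical all_reals all_analysis.

Set Implicit Arguments.
Unset Strict Implicit.
Unset Printing Implicit Defensive.

Import Order.TTheory GRing.Theory Num.Theory.

Local Open Scope classical_set_scope.
Local Open Scope ring_scope.

(* A point of X^n is a finite function, of type {ffun 'I_n -> X}. *)

Definition is_prob {R : realType} {U : finType} (mu : U -> R) : Prop :=
  (forall x, 0 <= mu x) /\ \sum_(x : U) mu x = 1.

Definition expect {R : realType} {U : finType} (mu h : U -> R) : R :=
  \sum_(x : U) mu x * h x.

Definition is_junta {R : realType} {X : finType} {n : nat} (k : nat)
    (h : {ffun 'I_n -> X} -> R) : Prop :=
  exists S : {set 'I_n}, #|S| = k /\
    forall x x' : {ffun 'I_n -> X},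
      (forall i, i \in S -> x i = x' i) -> h x = h x'.

Definition supnorm {R : realType} {U : finType} (g : U -> R) : R :=
  \big[Num.max/0]_(x : U) `|g x|.

(* The supremum is taken in [0, +oo]: it is +oo for an unbounded T, and the
   outer maximum only matters for T = set0, where it makes the value 0
   instead of -oo. *)
Definition Delta {R : realType} {U : finType} (T : set (U -> R)) : \bar R :=
  Order.max 0%E (ereal_sup [set (supnorm g)%:E | g in T]).

(* The convention 0 log 0 = 0 holds since the factor f x vanishes. *)
Definition relent {R : realType} {U : finType} (f mu : U -> R) : R :=
  expect mu (fun x => f x * ln (f x)).

(* Main.v *)
Require Import Defs.
From mathcomp Require Import all_boot all_order all_algebra.
From mathcomp Require Import all_classical all_reals all_analysis.
From mathcomp Require Import ring lra.

Set Implicit Arguments.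
Unset Strict Implicit.

Import Order.TTheory GRing.Theory Num.Theory.

Local Open Scope classical_set_scope.
Local Open Scope ring_scope.

(** Mirror descent with entropy as potential.  Start from [w = 1].  As long as
    some test [g] in [T] satisfies [E g (f - w) > eps], replace [w] by
    [w exp (eta g) / Z] with [eta = eps / (4 Delta^2)].  Each step enlarges the
    set of relevant coordinates by at most [k] and increases [E f ln w] by at
    least [eps^2 / (8 Delta^2)], whereas [E f ln w <= D(f || mu)] by Gibbs'
    inequality.  Hence there are at most [8 D Delta^2 / eps^2] steps. *)

(** * Expectations, Gibbs' inequality and a single descent step *)

Section Expectation.
Context {R : realType} {U : finType}.
Implicit Types mu f g h w : U -> R.

Lemma eq_expect mu g h : g =1 h -> expect mu g = expect mu h.
Proof. by move=> gh; apply: eq_bigr => x _; rewrite gh. Qed.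

Lemma expectD mu g h :
  expect mu (fun x => g x + h x) = expect mu g + expect mu h.
Proof. by rewrite /expect -big_split; apply: eq_bigr => x _; rewrite mulrDr. Qed.

Lemma expectZ mu (a : R) g : expect mu (fun x => a * g x) = a * expect mu g.
Proof. by rewrite /expect mulr_sumr; apply: eq_bigr => x _; rewrite mulrCA. Qed.

Lemma expectB mu g h :
  expect mu (fun x => g x - h x) = expect mu g - expect mu h.
Proof.
rewrite -mulN1r -expectZ -expectD.
by apply: eq_expect => x; rewrite mulN1r.
Qed.

Lemma expect_cst mu (a : R) : is_prob mu -> expect mu (fun=> a) = a.
Proof. by case=> _ mu1; rewrite /expect -mulr_suml mu1 mul1r. Qed.

Lemma le_expect mu g h : is_prob mu -> (forall x, g x <= h x) ->
  expect mu g <= expect mu h.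
Proof. by case=> mu0 _ gh; apply: ler_sum => x _; rewrite ler_wpM2l. Qed.

Lemma ln_le_subr1 (z : R) : 0 < z -> ln z <= z - 1.
Proof.
move=> z0; rewrite -{1}(subrK 1 z) addrC; apply: le_ln1Dx.
by rewrite ltrBrDr addNr.
Qed.

(** This is [ln z <= z - 1] at [z = b / a], multiplied by [a]. The term [a - b] cancels on average
    when both densities have mean 1. *)
Lemma gibbs_pointwise (a b : R) : 0 <= a -> 0 < b ->
  a * ln b + (a - b) <= a * ln a.
Proof.
rewrite le_eqVlt => /predU1P[<- b0|a0 b0].
  by rewrite !mul0r sub0r add0r oppr_le0 ltW.
have : ln (b / a) <= b / a - 1 by rewrite ln_le_subr1// divr_gt0.
rewrite lnM ?posrE ?invr_gt0// lnV ?posrE// => /(ler_wpM2l (ltW a0)).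
have -> : a * (b / a - 1) = b - a by field; rewrite gt_eqF.
rewrite mulrBr; lra.
Qed.

Lemma gibbs mu f w : is_prob mu -> (forall x, 0 <= f x) -> expect mu f = 1 ->
  (forall x, 0 < w x) -> expect mu w = 1 ->
  expect mu (fun x => f x * ln (w x)) <= relent f mu.
Proof.
move=> Pmu f0 f1 w0 w1.
have := le_expect Pmu (fun x => gibbs_pointwise (f0 x) (w0 x)).
by rewrite expectD expectB f1 w1 subrr addr0.
Qed.

(** From [1 - y <= expR (- y)] one gets [(1 - y) * expR y <= 1], while [1 - y] times the right-hand
    side is [1 + y ^+ 2 * (1 - 2 * y)], at least 1. *)
Lemma expR_le_quadratic (y : R) : `|y| <= 2^-1 -> expR y <= 1 + y + 2 * y ^+ 2.
Proof.
rewrite ler_norml => /andP[yl yu].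
have y1 : 0 < 1 - y by lra.
have h : 1 - y <= expR (- y) by exact: expR_ge1Dx.
have e0 : 0 < expR y := expR_gt0 y.
have : (1 - y) * expR y <= 1.
  by rewrite -[leRHS](expRxMexpNx_1 y) mulrC ler_wpM2l// ltW.
move=> le1; rewrite -(ler_pM2l y1); apply: (le_trans le1).
have : 0 <= y ^+ 2 * (1 - 2 * y) by rewrite mulr_ge0 ?sqr_ge0//; lra.
have -> : (1 - y) * (1 + y + 2 * y ^+ 2) = 1 + y ^+ 2 * (1 - 2 * y) by ring.
by rewrite lerDl.
Qed.

Lemma abs_expectM_le mu g w (a : R) : is_prob mu -> (forall x, `|g x| <= a) ->
  (forall x, 0 <= w x) -> expect mu w = 1 ->
  - a <= expect mu (fun x => g x * w x) <= a.
Proof.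
move=> Pmu ga w0 w1; apply/andP; split.
  rewrite -[leLHS]mulr1 -w1 -expectZ; apply: le_expect => // x.
  by apply: ler_wpM2r => //; have := ga x; rewrite ler_norml => /andP[].
rewrite -[leRHS]mulr1 -w1 -expectZ; apply: le_expect => // x.
by apply: ler_wpM2r => //; have := ga x; rewrite ler_norml => /andP[].
Qed.

Definition tilt mu w (eta : R) g : U -> R :=
  let Z := expect mu (fun x => w x * expR (eta * g x)) in
  fun x => w x * expR (eta * g x) / Z.

(** With step size [eta], the potential grows by [eta * Gf - ln Z], and [ln Z <= Z - 1 <= eta * Gw +
    2 * (eta * a) ^+ 2]. Hence the gain is at least [eta * eps - 2 * (eta * a) ^+ 2]; the chosen
    [eta] maximises this quadratic. *)
Lemma tilt_step mu f w g (a eps : R) : is_prob mu ->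
  (forall x, 0 <= f x) -> expect mu f = 1 ->
  (forall x, 0 < w x) -> expect mu w = 1 ->
  0 < a -> (forall x, `|g x| <= a) -> 0 < eps ->
  eps < expect mu (fun x => g x * (f x - w x)) ->
  let w' := tilt mu w (eps / (4 * a ^+ 2)) g in
  [/\ forall x, 0 < w' x, expect mu w' = 1 &
      expect mu (fun x => f x * ln (w x)) + eps ^+ 2 / (8 * a ^+ 2)
        <= expect mu (fun x => f x * ln (w' x))].
Proof.
move=> Pmu f0 f1 w0 w1 a0 ga eps0 viol w'.
have := viol; rewrite (eq_expect _ (fun x => mulrBr (g x) (f x) (w x))) expectB.
have w0' x : 0 <= w x by exact: ltW.
(* Both means of [g] lie in [[-a, a]], so the violation forces [eps < 2 * a]. This gives
   [eta * a <= 1/2], the range of the quadratic bound on [expR]. *)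
have /andP[_] := abs_expectM_le Pmu ga f0 f1.
have /andP[] := abs_expectM_le Pmu ga w0' w1.
set Gf := expect mu (fun x => g x * f x).
set Gw := expect mu (fun x => g x * w x).
move=> Gwl _ Gfu gap.
rewrite /w' /tilt; set eta := eps / (4 * a ^+ 2); set Z := expect mu _.
have eta0 : 0 < eta by rewrite divr_gt0// mulr_gt0// exprn_gt0.
have etaa : eta * a <= 2^-1.
  have -> : eta * a = eps / (4 * a) by rewrite /eta; field; rewrite gt_eqF.
  by rewrite ler_pdivrMr ?mulr_gt0//; lra.
have etag x : `|eta * g x| <= 2^-1.
  by rewrite normrM gtr0_norm// (le_trans _ etaa)// ler_pM2l.
have Zl : 2^-1 <= Z.
  have -> : 2^-1 = expect mu (fun x => 2^-1 * w x) by rewrite expectZ w1 mulr1.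
  apply: le_expect => // x.
  rewrite mulrC ler_pM2l// (le_trans _ (expR_ge1Dx _))//.
  by have := etag x; rewrite ler_norml => /andP[]; lra.
have Z0 : 0 < Z by apply: lt_le_trans Zl; rewrite invr_gt0.
have Zu : Z <= 1 + eta * Gw + 2 * (eta * a) ^+ 2.
  have -> : 1 + eta * Gw + 2 * (eta * a) ^+ 2 =
      expect mu (fun x => (1 + 2 * (eta * a) ^+ 2) * w x + eta * (g x * w x)).
    by rewrite expectD !expectZ w1 -/Gw; ring.
  apply: le_expect => // x.
  have -> : (1 + 2 * (eta * a) ^+ 2) * w x + eta * (g x * w x) =
    w x * (1 + eta * g x + 2 * (eta * a) ^+ 2) by ring.
  rewrite ler_pM2l// (le_trans (expR_le_quadratic _))// lerD2l ler_pM2l//.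
  rewrite -[leLHS]real_normK ?num_real// lerXn2r ?nnegrE//.
    by rewrite mulr_ge0// ltW.
  by rewrite normrM gtr0_norm// ler_pM2l.
have lnZ := ln_le_subr1 Z0.
split=> [x||].
- by rewrite divr_gt0// mulr_gt0// expR_gt0.
- rewrite (eq_expect _ (fun x => mulrC _ _)) expectZ -/Z mulVf//.
  by rewrite gt_eqF.
have -> : expect mu (fun x => f x * ln (w x * expR (eta * g x) / Z)) =
    expect mu (fun x => f x * ln (w x)) + eta * Gf - ln Z.
  rewrite -[ln Z]mulr1 -f1 -!expectZ -expectD -expectB; apply: eq_expect => x.
  rewrite lnM ?posrE ?mulr_gt0 ?invr_gt0 ?expR_gt0// lnV ?posrE//.
  by rewrite lnM ?posrE ?expR_gt0// expRK; ring.
have : eta * eps <= eta * (Gf - Gw) by rewrite ler_pM2l// ltW.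
have -> : eps ^+ 2 / (8 * a ^+ 2) = eta * eps - 2 * (eta * a) ^+ 2.
  by rewrite /eta; field; rewrite gt_eqF.
rewrite mulrBr; lra.
Qed.

Lemma ler_supnorm g x : `|g x| <= supnorm g.
Proof. by rewrite /supnorm; apply: le_bigmax. Qed.

Lemma supnorm_ge0 g : 0 <= supnorm g.
Proof. by rewrite /supnorm; apply: bigmax_ge_id. Qed.

End Expectation.

(** * Juntas and the descent for uniformly bounded tests *)

Section Juntas.
Context {R : realType} {X : finType} {n : nat}.
Local Notation U := {ffun 'I_n -> X}.
Implicit Types (mu f g h w : U -> R) (S : {set 'I_n}).

Definition depends_on S h :=
  forall x x' : U, (forall i, i \in S -> x i = x' i) -> h x = h x'.

(** The normalising factor is a constant and brings in no further coordinates. *)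
Lemma depends_on_tilt mu w (eta : R) g S S' : depends_on S w ->
  depends_on S' g -> depends_on (S :|: S')%SET (tilt mu w eta g).
Proof.
move=> wS gS x x' xx'; rewrite /tilt.
rewrite (wS x x') ?(gS x x')// => i iS; apply: xx'.
  by rewrite inE iS orbT.
by rewrite inE iS.
Qed.

Lemma junta0_cst (c : R) : is_junta 0 (fun _ : U => c).
Proof. by exists finset.set0; rewrite cards0. Qed.

(** Uniqueness allows 0-juntas found separately for different tests to serve as one common
    approximator. *)
Lemma junta0_eq1 mu h : is_prob mu -> is_junta 0 h -> expect mu h = 1 ->
  h = fun=> 1.
Proof.
move=> Pmu [S [/eqP]]; rewrite cards_eq0 => /eqP -> hS h1.
apply/funext => x; rewrite -h1 -[LHS](expect_cst _ Pmu).
by apply: eq_expect => y; apply: hS => i; rewrite inE.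
Qed.

(** The bound [a] is an arbitrary real, so the result applies with [a = Delta T] when this is
    finite, and to single tests when it is not. *)
Lemma junta_approx_bounded mu f (k : nat) (T : set (U -> R)) (a eps : R) :
  is_prob mu -> (forall x, 0 <= f x) -> expect mu f = 1 ->
  (forall g, T g -> is_junta k g) ->
  0 <= a -> (forall g, T g -> forall x, `|g x| <= a) -> 0 < eps ->
  exists (k' : nat) w,
    [/\ is_junta k' w, forall x, 0 <= w x, expect mu w = 1,
        k'%:R <= 8 * (k%:R / eps ^+ 2) * relent f mu * a ^+ 2 &
        forall g, T g -> expect mu (fun x => g x * (f x - w x)) <= eps].
Proof.
(* For [a = 0] the step size would divide by zero, but all tests vanish and the constant 1 works. *)
move=> Pmu f0 f1 Tk; rewrite le_eqVlt => /predU1P[<- T0 eps0|a0 Ta eps0].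
  exists 0%N, (fun=> 1); split=> //.
  - exact: junta0_cst.
  - by rewrite expect_cst.
  - by rewrite expr0n mulr0.
  move=> g Tg; rewrite (@eq_expect _ _ _ _ (fun=> 0)) ?expect_cst ?ltW// => x.
  have := T0 _ Tg x; rewrite normr_le0 => /eqP ->; exact: mul0r.
have e2 : 0 < eps ^+ 2 by rewrite exprn_gt0.
have a2 : 0 < a ^+ 2 by rewrite exprn_gt0.
pose c := eps ^+ 2 / (8 * a ^+ 2).
have c0 : 0 < c by rewrite divr_gt0// mulr_gt0.
(* If no suitable junta exists, the descent never stops, and [m] steps are possible for every
   [m]. *)
apply: contrapT => fail.
(* Coordinate sets of successive tests may overlap, so [#|S|] is only bounded by [m * k]; the junta
   size is then taken to be [#|S|] itself. *)
have step (m : nat) : exists S w, [/\ depends_on S w, forall x, 0 < w x,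
    expect mu w = 1, (#|S| <= m * k)%N &
    m%:R * c <= expect mu (fun x => f x * ln (w x))].
  elim: m => [|m [S [w [wS w0 w1 Sm pot]]]].
    exists finset.set0, (fun=> 1); split=> //; rewrite ?expect_cst ?cards0//.
    rewrite (@eq_expect _ _ _ _ (fun=> 0)) ?expect_cst ?mul0r// => x.
    by rewrite ln1 mulr0.
  have [g [Tg viol]] :
      exists g, T g /\ eps < expect mu (fun x => g x * (f x - w x)).
    apply: contrapT => ok; apply: fail; exists #|S|, w; split=> //.
    - by exists S.
    - by move=> x; exact: ltW.
    (* Gibbs' inequality gives [m * c <= D], hence [#|S| <= m * k <= (D / c) * k]. *)
    - have potD := le_trans pot (gibbs Pmu f0 f1 w0 w1).
      apply: (@le_trans _ _ (m%:R * k%:R)); first by rewrite -natrM ler_nat.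
      have -> : 8 * (k%:R / eps ^+ 2) * relent f mu * a ^+ 2 =
          relent f mu / c * k%:R.
        by rewrite /c; field; rewrite !gt_eqF.
      by rewrite ler_wpM2r// ler_pdivlMr.
    by move=> g Tg; rewrite leNgt; apply/negP => viol; apply: ok; exists g.
  have [S' [cS' gS']] := Tk g Tg.
  have [] := tilt_step Pmu f0 f1 w0 w1 a0 (Ta g Tg) eps0 viol.
  set w' := tilt _ _ _ _ => w'0 w'1 gain.
  exists (S :|: S')%SET, w'; split=> //.
  - exact: depends_on_tilt.
  - by rewrite (leq_trans (leq_card_setU _ _))// cS' mulSn addnC leq_add2l.
  by apply: le_trans gain; rewrite -natr1 mulrDl mul1r lerD2r.
(* More than [D / c] steps push the potential above [D], against Gibbs' inequality. *)
have [S [w [_ w0 w1 _ pot]]] := step (Num.bound `|relent f mu / c|).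
have := le_trans pot (gibbs Pmu f0 f1 w0 w1).
rewrite -ler_pdivlMr// leNgt => /negP; apply.
exact: le_lt_trans (ler_norm _) (archi_boundP (normr_ge0 _)).
Qed.

End Juntas.

(** * From a real bound to [Delta T], possibly infinite *)

Lemma supnorm_le_Delta {R : realType} {U : finType} (T : set (U -> R)) g :
  T g -> ((supnorm g)%:E <= Delta T)%E.
Proof.
move=> Tg; rewrite /Delta le_max; apply/orP; right.
by apply: ereal_sup_ubound; exists g.
Qed.

Theorem theorem4p8 (R : realType) :
  exists C : R, 0 < C /\
    forall (X : finType) (n : nat) (mu f : {ffun 'I_n -> X} -> R)
      (k : nat) (T : set ({ffun 'I_n -> X} -> R)),
      (1 <= n)%N ->
      is_prob mu ->
      (forall x, 0 <= f x) ->
      expect mu f = 1 ->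
      (forall g, T g -> is_junta k g) ->
      forall eps : R, 0 < eps ->
        exists (k' : nat) (ft : {ffun 'I_n -> X} -> R),
          [/\ is_junta k' ft,
              forall x, 0 <= ft x,
              expect mu ft = 1,
              (k'%:R%:E <=
                (C * (k%:R / eps ^+ 2) * relent f mu)%:E * Delta T ^+ 2)%E
            & forall g, T g -> expect mu (fun x => g x * (f x - ft x)) <= eps].
Proof.
exists 8; split=> // X n mu f k T _ Pmu f0 f1 Tk eps eps0.
have : (0 <= Delta T)%E by rewrite /Delta le_max lexx.
case E : (Delta T) => [a| |] // a0.
  have [] := junta_approx_bounded Pmu f0 f1 Tk (a := a) _ _ eps0.
  - by move: a0; rewrite lee_fin.
  - move=> g Tg x; apply: (le_trans (ler_supnorm g x)).
    by have := supnorm_le_Delta Tg; rewrite E lee_fin.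
  by move=> k' [w [? ? ? ? ?]]; exists k', w; split.
(* Now [Delta T] is [+oo]. Nonnegativity of the entropy is Gibbs' inequality for [w = 1]. *)
have D0 : 0 <= relent f mu.
  apply: le_trans (gibbs Pmu f0 f1 (fun=> ltr01) (expect_cst 1 Pmu)).
  rewrite (@eq_expect _ _ _ _ (fun=> 0)) ?expect_cst// => x.
  by rewrite ln1 mulr0.
set coef := 8 * _ * _.
have : 0 <= coef.
  by rewrite mulr_ge0// mulr_ge0// divr_ge0// exprn_ge0// ltW.
(* A positive [coef] makes the bound [+oo], and [f] itself is an [n]-junta. *)
have [coef0 _|coefn0 coefge0] := eqVneq coef 0; last first.
  exists n, f; split=> //.
  - exists finset.setT; split=> [|x x' xx']; first by rewrite cardsT card_ord.
    by congr f; apply/ffunP => i; apply: xx'.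
  - rewrite expe2 mulyy gt0_muley ?leey// lte_fin.
    by rewrite lt_neqAle eq_sym coefn0.
  move=> g _; rewrite (@eq_expect _ _ _ _ (fun=> 0)) ?expect_cst ?ltW// => x.
  by rewrite subrr mulr0.
(* Here the bound is [0 * +oo], which is 0 by convention, so a 0-junta is required. *)
exists 0%N, (fun=> 1); split=> //.
- exact: junta0_cst.
- exact: expect_cst.
- by rewrite coef0 mul0e.
(* The bounded case for the single test [g] yields a 0-junta, which is 1. *)
move=> g Tg.
have gk h : [set g] h -> is_junta k h by move=> ->; exact: Tk.
have gb h : [set g] h -> forall x, `|h x| <= supnorm g.
  by move=> -> x; exact: ler_supnorm.
have [k' [w [wk _ w1]]] :=
  junta_approx_bounded Pmu f0 f1 gk (supnorm_ge0 g) gb eps0.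
rewrite -/coef coef0 mul0r lern0 => /eqP k'0 /(_ g erefl).
by move: wk; rewrite k'0 => /(junta0_eq1 Pmu) /(_ w1) ->.
Qed.
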